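(* There is an absolute constant $C>0$ such that for every connected graph $G$ on $n\ge 2$ vertices, $$\mathcal{AC}(G)\le C\,\frac{n^2}{\log n}.$$
   Context: Acquaintance time: on a finite connected graph $G$, one agent is initially placed on each vertex; two agents become (permanently) acquainted whenever they occupy adjacent vertices at some point (including at the start). In each round one chooses a matching of $G$ and swaps the agents at the endpoints of each matching edge. $\mathcal{AC}(G)$ is the minimum number of rounds until all pairs of agents are acquainted. *)

(* Defs.v *)
From mathcomp Require Import all_boot.

Set Implicit Arguments.
Unset Strict Implicit.
Unset Printing Implicit Defensive.

Record sgraph := SGraph {
  vertex :> finType;
  adj : rel vertex;
  adj_sym : symmetric adj;
  adj_irr : irreflexive adj }.

Definition connected_graph (G : sgraph) : Prop :=
  forall x y : G, connect (@adj G) x y.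

Section Acquaintance.

Variable G : sgraph.

Definition edges : {set {set G}} :=
  [set [set p.1; p.2] | p in [set p : G * G | adj p.1 p.2]].

Definition matching (M : {set {set G}}) : bool :=
  (M \subset edges) && trivIset M.

(* If M is a matching, there is at most one w with {v, w} in M. *)
Definition swap (M : {set {set G}}) (v : G) : G :=
  odflt v [pick w | [set v; w] \in M].

(* Agents are named after their initial vertices. *)
Definition position (s : seq {set {set G}}) (a : G) : G :=
  foldl (fun v M => swap M v) a s.

(* The round t = 0 is the initial placement. *)
Definition acquainted (s : seq {set {set G}}) (a b : G) : bool :=
  [exists t : 'I_(size s).+1,
     adj (position (take t s) a) (position (take t s) b)].

Definition acquaints_all (s : seq {set {set G}}) : bool :=
  [forall a, forall b, (a != b) ==> acquainted s a b].

Definition acquaintable_in (k : nat) : bool :=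
  [exists s : k.-tuple {set {set G}}, all matching s && acquaints_all s].

Lemma edgesP (x y : G) : ([set x; y] \in edges) = adj x y.
Proof.
apply/imsetP/idP => [[[u v]] /= | xy]; last by exists (x, y); rewrite ?inE.
rewrite inE /= => uv E.
have ux : u \in [set x; y] by rewrite E !inE eqxx.
have vx : v \in [set x; y] by rewrite E !inE eqxx orbT.
move: ux vx uv; rewrite !inE => /orP[]/eqP-> /orP[]/eqP-> //;
  by rewrite ?adj_irr // adj_sym.
Qed.

Lemma swap_edge (M : {set {set G}}) (x y : G) :
  matching M -> [set x; y] \in M -> swap M x = y.
Proof.
move=> /andP[/subsetP sM /trivIsetP tM] xyM; rewrite /swap.
case: pickP => [w xwM|/(_ y)]; last by rewrite xyM.
have xNz z : [set x; z] \in M -> z != x.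
  move=> /sM; rewrite edgesP; apply: contraTneq => ->.
  by rewrite adj_irr.
have [E|N] := eqVneq [set x; w] [set x; y].
  have: w \in [set x; y] by rewrite -E !inE eqxx orbT.
  by rewrite !inE (negPf (xNz _ xwM)) => /eqP.
have /pred0P/(_ x) := tM _ _ xwM xyM N.
by rewrite /= !inE eqxx.
Qed.

Lemma swap_id (M : {set {set G}}) (x : G) :
  (forall y, [set x; y] \notin M) -> swap M x = x.
Proof. by move=> H; rewrite /swap; case: pickP => // y; rewrite (negPf (H y)). Qed.

Lemma swapK (M : {set {set G}}) : matching M -> involutive (swap M).
Proof.
move=> mM x; rewrite {2}/swap; case: pickP => [y xyM|nM] /=.
  by apply: swap_edge; rewrite // setUC.
by apply: swap_id => y; rewrite nM.
Qed.

Lemma position_inj (s : seq {set {set G}}) :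
  all matching s -> injective (position s).
Proof.
elim: s => [_ x y|M s IHs] //= /andP[mM ms] x y /(IHs ms).
exact: (can_inj (swapK mM)).
Qed.

Lemma position_cat (s s' : seq {set {set G}}) (a : G) :
  position (s ++ s') a = position s' (position s a).
Proof. by rewrite /position foldl_cat. Qed.

Lemma acquainted_cat (s s' : seq {set {set G}}) (a b : G) :
  acquainted s a b -> acquainted (s ++ s') a b.
Proof.
case/existsP=> t tP; have ts : (t <= size s)%N by rewrite -ltnS.
have tss : (t < (size (s ++ s')).+1)%N by rewrite ltnS size_cat (leq_trans ts) ?leq_addr.
by apply/existsP; exists (Ordinal tss) => /=; rewrite takel_cat.
Qed.

Lemma meet (p : seq G) (u : G) : path (@adj G) u p -> uniq (u :: p) ->
  u != last u p ->
  exists2 s, all matching s & adj (position s u) (position s (last u p)).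
Proof.
elim: p u => [u _ _|w [|w' p] IH u]; first by rewrite eqxx.
  by move=> /= /andP[uw _] _ _; exists [::].
rewrite [path _ _ _]/= -/(path _ w _) => /andP[uw pw].
rewrite cons_uniq => /andP[uN U] _ /=.
have NwL : w != last w (w' :: p).
  by case/andP: U => wN _; apply: contra wN => /eqP->; rewrite /= mem_last.
case: (IH w pw U NwL) => s ms /= As.
pose M : {set {set G}} := [set [set u; w]].
have mM : matching M.
  rewrite /matching sub1set edgesP uw /=; apply/trivIsetP => A B.
  by rewrite !inE => /eqP-> /eqP->; rewrite eqxx.
exists (M :: s); first by rewrite /= mM.
rewrite /= (swap_edge (y := w)) ?inE // swap_id // => y.
rewrite inE; apply/eqP => E.
have: last w' p \in [set u; w] by rewrite -E !inE eqxx.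
rewrite !inE => /orP[]/eqP L.
  by move: uN; rewrite -L inE mem_last orbT.
by move: NwL; rewrite /= L eqxx.
Qed.

Lemma acquaintable : connected_graph G -> exists k, acquaintable_in k.
Proof.
move=> cG.
suff H (l : seq (G * G)) : exists2 s, all matching s &
    all (fun p => (p.1 != p.2) ==> acquainted s p.1 p.2) l.
  case: (H (enum {: G * G})) => s ms /allP As.
  exists (size s); apply/existsP; exists (in_tuple s); rewrite /= ms /=.
  apply/forallP => a; apply/forallP => b.
  by apply: (As (a, b)); rewrite mem_enum.
elim: l => [|[a b] l [s ms As]]; first by exists [::].
have [->|ab] := eqVneq a b; first by exists s => //=; rewrite eqxx.
have /connectP[p pP pL] := cG (position s a) (position s b).
have {p pP pL} [s' ms' As'] : exists2 s', all matching s' &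
    adj (position s' (position s a)) (position s' (position s b)).
  have: position s a != position s b by rewrite (inj_eq (position_inj ms)).
  rewrite pL; case/shortenP: pP {pL} => q qP qU _; exact: meet.
exists (s ++ s'); first by rewrite all_cat ms ms'.
rewrite /= ab /=; apply/andP; split.
  by apply/existsP; exists ord_max; rewrite /= take_size !position_cat.
apply: sub_all As => -[c d] /= /implyP cd; apply/implyP => /cd.
exact: acquainted_cat.
Qed.

Definition acquaintance_time (cG : connected_graph G) : nat :=
  ex_minn (acquaintable cG).

End Acquaintance.

(* Main.v *)
Require Import Defs.
From mathcomp Require Import all_boot all_order all_algebra.
From mathcomp Require Import fingroup perm zify.
From mathcomp Require Import reals exp.

(* Write n for the order of G, and let d be about log n.

   If all degrees are below d, the cube of G has a Hamiltonian path.  Odd-even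
   transposition along this path swaps every pair of agents within n rounds.
   A swap of two vertices at distance at most 3 takes 5 rounds of G and makes
   the two agents adjacent meanwhile, and the swaps of one round can be
   coloured with O(d^3) colours so that those of the same colour use disjoint
   walks.  The total is O(n d^3).

   If some vertex v has a set N of at least d neighbours, keep a group of
   agents on N while all other agents visit v one after the other: each visitor
   meets the whole group at once.  Contracting N into v gives a connected graph
   with a spanning tree rooted at v, in which agents that have not yet visited v
   are pulled towards the root; doing so alternately at even and odd depths
   delivers one of them every two rounds, so that everyone visits v in O(n)
   rounds.  A new group is loaded on N in the same way, by swapping visitors of
   v into N.  With n/d groups the total is O(n^2/d). *)

Set Implicit Arguments.
Unset Strict Implicit.
Unset Printing Implicit Defensive.

(** * Simultaneous swaps along disjoint walks *)

Section Rounds.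

Variable G : sgraph.
Implicit Types (x y z a b : G) (s : seq {set {set G}}).

Definition lazy x y := (x == y) || adj x y.

Lemma lazy_sym : symmetric lazy.
Proof. by move=> x y; rewrite /lazy eq_sym adj_sym. Qed.

Lemma adj_neq x y : adj x y -> x != y.
Proof. by apply: contraTneq => ->; rewrite adj_irr. Qed.

Lemma acquainted_now s s' a b :
  adj (position s a) (position s b) -> acquainted (s ++ s') a b.
Proof.
move=> ab; have st : size s < (size (s ++ s')).+1 by rewrite ltnS size_cat leq_addr.
by apply/existsP; exists (Ordinal st); rewrite /= take_size_cat.
Qed.

Lemma acquainted_catr s s' a b :
  acquainted s' (position s a) (position s b) -> acquainted (s ++ s') a b.
Proof.
case/existsP=> t ab; have st : size s + t < (size (s ++ s')).+1.
  by rewrite ltnS size_cat leq_add2l -ltnS.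
by apply/existsP; exists (Ordinal st); rewrite /= takeD take_size_cat ?drop_size_cat // !position_cat.
Qed.

Lemma acquainted_sym s : symmetric (acquainted s).
Proof. by move=> a b; apply: eq_existsb => t; rewrite adj_sym. Qed.

(** Private territories [A i], larger than the edge used, let rounds with the same territories
    compose to products of transpositions. An index with [e i = f i] idles. *)
Lemma parallel_step (I : finType) (C : pred I) (A : I -> {set G}) (e f : I -> G) :
    (forall i, C i -> [/\ e i \in A i, f i \in A i & lazy (e i) (f i)]) ->
    (forall i j x, C i -> C j -> x \in A i -> x \in A j -> i = j) ->
  exists2 M, matching M &
    (forall i x, C i -> x \in A i -> swap M x = tperm (e i) (f i) x) /\
    (forall x, (forall i, C i -> x \notin A i) -> swap M x = x).
Proof.
move=> Aef Adis.
pose M := [set [set e i; f i] | i in [pred i | C i && (e i != f i)]].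
have MP x y : [set x; y] \in M ->
    exists2 i, C i & [/\ e i != f i, x \in A i & [set x; y] = [set e i; f i]].
  case/imsetP=> i /andP[Ci ef] E; exists i => //; split=> //.
  have [eA fA _] := Aef i Ci.
  have: x \in [set e i; f i] by rewrite -E !inE eqxx.
  by rewrite !inE => /orP[]/eqP->.
have mM : matching M.
  apply/andP; split.
    apply/subsetP => B /imsetP[i /andP[Ci ef] ->]; rewrite edgesP.
    by have [_ _ /orP[E|//]] := Aef i Ci; rewrite E in ef.
  apply/trivIsetP => B D /imsetP[i /andP[Ci ef] ->] /imsetP[j /andP[Cj ef'] ->] BD.
  apply/pred0P => z; apply/negbTE/negP => /andP[/= zi zj].
  have [ei fi _] := Aef i Ci; have [ej fj _] := Aef j Cj.
  have E : i = j.
    apply: (Adis i j z) => //.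
      by move: zi; rewrite !inE => /orP[]/eqP->.
    by move: zj; rewrite !inE => /orP[]/eqP->.
  by rewrite E eqxx in BD.
exists M => //; split=> [i x Ci xA|x nx]; last first.
  by apply: swap_id => y; apply/negP => /MP[i Ci [_ xA _]]; case/negP: (nx i Ci).
have [ef|ef] := eqVneq (e i) (f i).
  rewrite ef tperm1 perm1; apply: swap_id => y; apply/negP => /MP[j Cj [ef' xA' _]].
  by rewrite (Adis j i x) // ef eqxx in ef'.
have efM : [set e i; f i] \in M by apply: imset_f; rewrite inE /= Ci.
case: tpermP => [->|->|/eqP xe /eqP xf]; first exact: swap_edge.
  by apply: swap_edge; rewrite // setUC.
apply: swap_id => y; apply/negP => /MP[j Cj [_ xA' E]].
have: x \in [set e j; f j] by rewrite -E !inE eqxx.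
by rewrite (Adis j i x) // !inE (negPf xe) (negPf xf).
Qed.

Definition exchanges (I : finType) (C : pred I) (x y : I -> G) s :=
  [/\ all (@matching G) s,
      forall i, C i -> [/\ position s (x i) = y i, position s (y i) = x i &
                           acquainted s (x i) (y i)] &
      forall z, (forall i, C i -> z != x i /\ z != y i) -> position s z = z].

Definition route x a b y := [&& lazy x a, lazy a b, adj b y & y \notin [:: x; a; b]].

(** At distance 1 or 2 a shorter walk is padded; at distance 3 the given walk cannot pause or meet
    [y] early. *)
Lemma route_of_walk x a b y :
  x != y -> lazy x a -> lazy a b -> lazy b y -> exists a' b', route x a' b' y.
Proof.
move=> xy xa ab by_.
have [xyA|xyN] := boolP (adj x y).
  by exists x, x; rewrite /route /lazy !eqxx xyA !inE eq_sym (negPf xy).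
have [/existsP[c /andP[xc cy]]|noC] := boolP [exists c, adj x c && adj c y].
  exists x, c; rewrite /route /lazy !eqxx xc cy orbT !inE !(eq_sym y) (negPf xy).
  by rewrite (negPf (adj_neq cy)).
have noc c : adj x c -> adj c y -> False.
  by move=> xc cy; case/existsP: noC; exists c; rewrite xc.
exists a, b; rewrite /route xa ab !inE !(eq_sym y) (negPf xy) /=.
case/orP: by_ => [/eqP E|by_]; last rewrite by_ (negPf (adj_neq by_)) /= orbF.
  rewrite {}E in ab *; case/orP: xa => [/eqP xa|xa]; case/orP: ab => [/eqP ay|ay].
  - by rewrite xa ay eqxx in xy.
  - by rewrite xa ay in xyN.
  - by rewrite -ay xa in xyN.
  - by case: (noc a).
apply: contraNneq xyN => E; case/orP: xa => [/eqP E'|]; last by rewrite E.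
by rewrite E' E eqxx in xy.
Qed.

(** Conjugating [(b y)] by [(a b)] gives [(a y)], and then by [(x a)] gives [(x y)], even when some
    of [x], [a], [b] coincide. *)
Lemma tperm_conj3 (x a b y z : G) : y \notin [:: x; a; b] ->
  tperm x a (tperm a b (tperm b y (tperm a b (tperm x a z)))) = tperm x y z.
Proof.
rewrite !inE !negb_or => /and3P[yx ya yb].
have xay : (tperm a y ^ tperm x a)%g = tperm x y.
  by rewrite tpermJ tpermR tpermD // eq_sym.
have aby : (tperm b y ^ tperm a b)%g = tperm a y.
  by rewrite tpermJ tpermR tpermD // eq_sym.
by rewrite -xay -aby /conjg !tpermV !permM.
Qed.

(* The five transpositions xa, ab, by, ab, xa compose to the transposition xy,
   and the agents of x and y are adjacent after the first two. *)
Lemma parallel_swap (I : finType) (C : pred I) (x a b y : I -> G) :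
    (forall i, C i -> route (x i) (a i) (b i) (y i)) ->
    (forall i j z, C i -> C j -> z \in [:: x i; a i; b i; y i] ->
       z \in [:: x j; a j; b j; y j] -> i = j) ->
  exists2 s, exchanges C x y s & size s = 5.
Proof.
move=> rt dis.
pose A i : {set G} := [set z | z \in [:: x i; a i; b i; y i]].
have Adis i j z : C i -> C j -> z \in A i -> z \in A j -> i = j.
  by move=> Ci Cj; rewrite 2!in_set; apply: dis.
have xA i : x i \in A i by rewrite !inE eqxx.
have aA i : a i \in A i by rewrite !inE eqxx ?orbT.
have bA i : b i \in A i by rewrite !inE eqxx ?orbT.
have yA i : y i \in A i by rewrite !inE eqxx ?orbT.
have tA i z u w : u \in A i -> w \in A i -> z \in A i -> tperm u w z \in A i.
  by move=> uA wA zA; case: tpermP.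
have [i Ci|M1 m1 [S1 S1']] := @parallel_step I C A x a _ Adis.
  by have /and4P[] := rt i Ci.
have [i Ci|M2 m2 [S2 S2']] := @parallel_step I C A a b _ Adis.
  by have /and4P[] := rt i Ci.
have [i Ci|M3 m3 [S3 S3']] := @parallel_step I C A b y _ Adis.
  by have /and4P[_ _ h _] := rt i Ci; split=> //; apply/orP; right.
exists [:: M1; M2; M3; M2; M1] => //.
have pA i z : C i -> z \in A i ->
    position [:: M1; M2; M3; M2; M1] z = tperm (x i) (y i) z.
  move=> Ci zA; have /and4P[_ _ _ yN] := rt i Ci.
  rewrite /position /= (S1 i z) // (S2 i) ?tA // (S3 i) ?tA // (S2 i) ?tA ?(S1 i) ?tA //.
  exact: tperm_conj3.
split=> [|i Ci|z nz]; first by rewrite /= m1 m2 m3.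
  rewrite !(pA i) // tpermL tpermR; split=> //.
  apply: (@acquainted_now [:: M1; M2] [:: M3; M2; M1]); rewrite /position /=.
  have /and4P[_ _ byA] := rt i Ci; rewrite !inE !negb_or => /and3P[yx ya yb].
  rewrite !(S1 i) // tpermL !(S2 i) ?tA // tpermL.
  by rewrite (tpermD (z := y i)) 1?eq_sym // tpermD 1?eq_sym.
have [/existsP[i /andP[Ci zA]]|zN] := boolP [exists i, C i && (z \in A i)].
  by rewrite (pA i) //; have [zx zy] := nz i Ci; rewrite tpermD // eq_sym.
have {}zN i : C i -> z \notin A i.
  by move=> Ci; apply: contra zN => zA; apply/existsP; exists i; rewrite Ci.
by rewrite /position /= S1' // S2' // S3' // S2' // S1'.
Qed.

(** The colours are processed in turn. Walks of different colours may cross, since an exchange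
    restores every agent but its own two. *)
Lemma schedule_swap (I : finType) (C : pred I) (x a b y : I -> G)
    (K : nat) (col : I -> nat) :
    (forall i, C i -> route (x i) (a i) (b i) (y i)) ->
    (forall i j z, C i -> C j -> z \in [:: x i; y i] -> z \in [:: x j; y j] -> i = j) ->
    (forall i, C i -> col i < K) ->
    (forall i j z, C i -> C j -> col i = col j -> z \in [:: x i; a i; b i; y i] ->
       z \in [:: x j; a j; b j; y j] -> i = j) ->
  exists2 s, exchanges C x y s & size s = 5 * K.
Proof.
move=> rt endp colK dis.
suff H k : exists2 s, exchanges [pred i | C i && (col i < k)] x y s & size s = 5 * k.
  have [s [ms ex fx] sz] := H K; exists s => //; split=> // [i Ci|z nz].
    by apply: ex; rewrite /= Ci colK.
  by apply: fx => i /andP[Ci _]; apply: nz.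
elim: k => [|k [s [ms ex fx] sz]].
  by exists [::] => //; split=> // i /=; rewrite ltn0 andbF.
have [i /andP[Ci _]|i j z /andP[Ci /eqP ci] /andP[Cj /eqP cj]|s' [ms' ex' fx'] sz'] :=
    @parallel_swap I [pred i | C i && (col i == k)] x a b y.
- exact: rt.
- by apply: dis => //; rewrite ci.
exists (s ++ s'); last by rewrite size_cat sz sz' mulnS addnC.
have nend i j z : C i -> C j -> i != j -> z \in [:: x i; y i] -> z != x j /\ z != y j.
  move=> Ci Cj ij zi; apply/andP; rewrite -negb_or; apply: contraNN ij => zj.
  by apply/eqP; apply: (endp i j z) => //; rewrite !inE.
split=> [|i /andP[Ci]|z nz]; first by rewrite all_cat ms.
  rewrite ltnS leq_eqVlt !position_cat => /orP[/eqP ci|ci].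
    have fi z : z \in [:: x i; y i] -> position s z = z.
      move=> zi; apply: fx => j /andP[Cj cj]; apply: nend zi => //.
      by apply: contraTneq cj => <-; rewrite ci ltnn.
    have [|p1 p2 aq] := ex' i; first by rewrite /= Ci ci eqxx.
    by split; [rewrite fi ?inE ?eqxx|rewrite fi ?inE ?eqxx ?orbT|
      apply: acquainted_catr; rewrite !fi ?inE ?eqxx ?orbT].
  have fi z : z \in [:: x i; y i] -> position s' z = z.
    move=> zi; apply: fx' => j /andP[Cj /eqP cj]; apply: nend zi => //.
    by apply: contraTneq ci => ->; rewrite cj ltnn.
  have [|-> -> aq] := ex i; first by rewrite /= Ci.
  by rewrite !fi ?inE ?eqxx ?orbT //; split=> //; apply: acquainted_cat.
rewrite position_cat fx ?fx' // => i /andP[Ci ci]; apply: nz; rewrite /= Ci.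
  by rewrite (eqP ci) ltnSn.
by rewrite ltnW.
Qed.

End Rounds.

(** * A vertex of high degree *)

(** On reachable vertices [dep] is the distance from [v]; the last step of a shortest path crosses
    exactly one layer. *)
Lemma connect_parent (T : finType) (h : rel T) (v : T) :
  exists dep : T -> nat, dep v = 0 /\ forall x, connect h v x -> x != v ->
    exists2 y, h y x & dep x = (dep y).+1.
Proof.
pose L k x := [exists p : k.-tuple T, path h v p && (last v p == x)].
have LP k x : reflect (exists2 p, path h v p & x = last v p /\ size p = k) (L k x).
  apply: (iffP existsP) => [[p /andP[hp /eqP <-]]|[p hp [-> <-]]].
    by exists p; rewrite ?size_tuple.
  by exists (in_tuple p); rewrite hp eqxx.
have exL x : connect h v x -> exists k, L k x.
  by case/connectP=> p hp xp; exists (size p); apply/LP; exists p.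
pose dep x := if connect h v x =P true is ReflectT c then ex_minn (exL x c) else 0.
have depL x k : L k x -> L (dep x) x /\ dep x <= k.
  move=> Lk; have c : connect h v x.
    by case/LP: Lk => p hp [xp _]; apply/connectP; exists p.
  rewrite /dep; case: eqP => [c'|//]; case: ex_minnP => m Lm min; split=> //; exact: min.
exists dep; split.
  by have /depL[_] : L 0 v by [apply/LP; exists [::]]; case: (dep v).
move=> x c xv; have [k Lk] := exL x c.
have [/LP[p hp [xp sp]] _] := depL x k Lk.
case/lastP: p hp xp sp => [|p z]; first by move=> _ /eqP; rewrite (negPf xv).
rewrite rcons_path last_rcons size_rcons => /andP[hp hz] -> sp; exists (last v p) => //.
have /depL[/LP[q hq [yq sq]] le] : L (size p) (last v p) by apply/LP; exists p.
have /depL[_ le'] : L (dep (last v p)).+1 z.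
  by apply/LP; exists (rcons q z); rewrite ?rcons_path ?last_rcons ?size_rcons ?hq -?yq ?sq.
by move: sp le le'; lia.
Qed.

Section Hub.

Variables (G : sgraph) (v : G) (N : {set G}).
Hypotheses (cG : connected_graph G) (vN : forall u, u \in N -> adj v u).

Let v_notin : v \notin N.
Proof. by apply/negP => /vN; rewrite adj_irr. Qed.

(* [N] contracted into the hub [v]; an edge of [v] then stands for a walk of
   length at most 2. *)
Let hub_adj x y :=
  [&& x \notin N, y \notin N & adj x y || (x == v) && [exists u in N, adj u y]].

(** If a path of [G] enters [z] from [N], a single hub edge leads from [v] to [z]. *)
Let hub_connect x : x \notin N -> connect hub_adj v x.
Proof.
have /connectP[p] := cG v x; elim/last_ind: p x => [|p z IH] x; first by move=> _ -> _; rewrite connect0.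
rewrite rcons_path last_rcons => /andP[hp yz] -> zN.
have [yN|yN] := boolP (last v p \in N).
  apply: connect1; rewrite /hub_adj v_notin zN eqxx /=; apply/orP; right.
  by apply/existsP; exists (last v p); rewrite yN.
apply: connect_trans (IH _ hp erefl yN) _; apply: connect1.
by rewrite /hub_adj yN zN yz.
Qed.

(** With [par] fixing [v] and [N], its iterates are total: from outside [N] they end at [v], and
    inside [N] they stay put. *)
Let hub_tree : exists (par : G -> G) (dep : G -> nat), (forall u, u \in v |: N -> par u = u) /\
  dep v = 0 /\ forall x, x \notin N -> x != v ->
    [/\ par x \notin N, dep x = (dep (par x)).+1 &
        adj (par x) x || (par x == v) && [exists u in N, adj u x]].
Proof.
have [dep [dep_v H]] := connect_parent hub_adj v.
exists (fun x => if x \in v |: N then x else odflt v [pick y | hub_adj y x && (dep x == (dep y).+1)]).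
exists dep; split=> [u ->//|]; split=> // x xN xv.
rewrite !inE (negPf xv) (negPf xN); case: pickP => [y /andP[/and3P[yN _ yx] /eqP]//|no].
have [y yx dx] := H x (hub_connect xN) xv.
by move: (no y); rewrite yx dx eqxx.
Qed.

(** Only block boundaries count, as loading takes place between blocks. *)
Definition visits (bs : seq (seq {set {set G}})) y :=
  exists k, position (flatten (take k bs)) y = v.

(** The 10 stands for two draining rounds, one for each parity, of 5 rounds of [G] each. *)
Definition block b :=
  [/\ all (@matching G) b, size b = 10 & forall u, u \in N -> position b u = u].

Section HubTree.

Variables (par : G -> G) (dep : G -> nat).
Hypothesis par_id : forall u, u \in v |: N -> par u = u.
Hypothesis dep_v : dep v = 0.
Hypothesis parP : forall x, x \notin N -> x != v ->
    [/\ par x \notin N, dep x = (dep (par x)).+1 &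
        adj (par x) x || (par x == v) && [exists u in N, adj u x]].

(* [W] is the set of positions of the agents that have not yet visited [v].
   In a round, each vertex outside [W] whose depth does not have parity [b]
   swaps with a child in [W], if there is one; vertices of parity [b] being
   drained, this makes those of the other parity, [v] included, drained. *)
Let drained b (W : {set G}) x := x \notin N -> odd (dep x) = b -> x \notin W ->
  forall k y, iter k par y = x -> y \notin W.

(** A vertex of the new parity that is outside [W] afterwards was so before and had no child in [W];
    its children have parity [b] and were drained. *)
Let drain_round b (W : {set G}) : W \subset ~: N ->
    (forall x, x != v -> drained b W x) ->
  exists s, [/\ all (@matching G) s, size s = 5, forall u, u \in N -> position s u = u &
    forall x, drained (~~ b) (position s @: W) x].
Proof.
move=> WN inv.
have WnN x : x \in W -> x \notin N by move/(subsetP WN); rewrite inE.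
pose child r c := [&& c \in W, c != v & par c == r].
pose C r := [&& r \notin N, r \notin W, odd (dep r) == ~~ b & [exists c, child r c]].
pose c r := odflt r [pick c | child r c].
have cP r : C r -> child r (c r).
  case/and4P=> _ _ _ /existsP[z rz]; rewrite /c; case: pickP => [//|no].
  by rewrite no in rz.
(* If [r] and [c r] are not adjacent, then [r = v] and the walk goes through [N]. *)
pose bd r := if adj r (c r) then r else odflt r [pick u in N | adj u (c r)].
have bdP r : C r -> route r r (bd r) (c r) /\ (bd r = r \/ r = v /\ bd r \in N).
  move=> Cr; have /and3P[cW cv /eqP pc] := cP r Cr; have /and4P[rN rW _ _] := Cr.
  have cr : c r != r by apply: contraNneq rW => <-.
  have [_ _] := parP (WnN _ cW) cv; rewrite pc /bd /route {1}/lazy eqxx.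
  case: ifP => [rc _|rc /= /andP[/eqP rv /existsP[u uP]]].
    by split; [rewrite /lazy eqxx rc !inE (negPf cr)|left].
  case: pickP => [w /andP[wN wc]|/(_ u)]; last by rewrite uP.
  split; last by right.
  have rw : adj r w by rewrite rv vN.
  by rewrite /= /lazy rw orbT wc !inE (negPf cr) /= eq_sym adj_neq.
have [r Cr|r r' z Cr Cr'|s [ms ex fx] sz] := @parallel_swap G _ C id id bd c.
- by have [] := bdP r Cr.
- have [_ br] := bdP r Cr; have [_ br'] := bdP r' Cr'.
  have /and3P[cW cv /eqP pc] := cP r Cr; have /and4P[rN rW _ _] := Cr.
  have /and3P[cW' cv' /eqP pc'] := cP r' Cr'; have /and4P[rN' rW' _ _] := Cr'.
  have cN := WnN _ cW; have cN' := WnN _ cW'.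
  have zE q : bd q = q \/ q = v /\ bd q \in N -> z \in [:: q; q; bd q; c q] ->
      [\/ z = q, q = v /\ z \in N | z = c q].
    rewrite !inE => -[->|[-> bN]] /or4P[]/eqP->; by [constructor 1|constructor 2|constructor 3].
  case/(zE _ br) => [E|[E zN]|E] /(zE _ br')[E'|[E' zN']|E']; subst=> //.
  + by rewrite zN' in rN.
  + by rewrite cW' in rW.
  + by rewrite zN in rN'.
  + by rewrite zN in cN'.
  + by rewrite cW in rW'.
  + by rewrite zN' in cN.
  + by rewrite -pc -pc' E'.
have sN u : u \in N -> position s u = u.
  move=> uN; apply: fx => r Cr; have /and3P[cW _ _] := cP r Cr; have /and4P[rN _ _ _] := Cr.
  by split; apply: contraTneq uN => ->; rewrite // WnN.
exists s; split=> // x xN xb xW k y yx.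
have sK z : position s (position s z) = z.
  have [/existsP[r /andP[Cr]]|no] := boolP [exists r, C r && ((z == r) || (z == c r))].
    by have [E1 E2 _] := ex r Cr; case/orP=> /eqP->; rewrite ?E1 ?E2 ?E1.
  have E : position s z = z.
    apply: fx => r Cr; apply/andP; rewrite -negb_or; apply: contra no => zr.
    by apply/existsP; exists r; rewrite Cr.
  by rewrite !E.
have memW z : (z \in position s @: W) = (position s z \in W).
  apply/imsetP/idP => [[w wW ->]|zW]; first by rewrite sK.
  by exists (position s z).
have WX : x \notin W.
  apply/negP => xW0; move: xW; rewrite memW fx ?xW0 // => r Cr.
  have /and4P[_ rW /eqP rb _] := Cr; have /and3P[cW cv /eqP pc] := cP r Cr.
  split; first by apply: contraTneq xW0 => ->.
  apply: contra_eqN xb => /eqP->.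
  have [_ -> _] := parP (WnN _ cW) cv; rewrite /= pc rb negbK.
  by case: (b).
have xC : ~~ C x.
  apply/negP => Cx; have [E _ _] := ex x Cx; have /and3P[cW _ _] := cP x Cx.
  by move: xW; rewrite memW E cW.
have kidN z : par z = x -> z != v -> z \notin W.
  move=> pz zv; apply: contra xC => zW; apply/and4P; split=> //; first by apply/eqP.
  by apply/existsP; exists z; rewrite /child zW zv pz eqxx.
have below j w : iter j par w = x -> w \notin W.
  elim: j w => [|j IH] w /=; first by move->.
  move=> pz; set z := iter j par w in pz.
  have [zN|zN] := boolP (z \in N).
    by case/negP: xN; rewrite -pz par_id // !inE zN orbT.
  have [zv|zv] := eqVneq z v; first by apply: IH; rewrite -/z -pz par_id // !inE zv eqxx.
  have [_ dz _] := parP zN zv.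
  apply: (inv z zv zN _ (kidN z pz zv) j) => //.
  by rewrite dz pz /= xb negbK.
(* [y = r] is impossible, as [c r] would be in [W] and below [x]; at [y = c r] now stands the former
   agent of [r], outside [W]. *)
rewrite memW; have [/existsP[r /andP[Cr]]|no] := boolP [exists r, C r && ((y == r) || (y == c r))].
  have /and3P[cW _ /eqP pc] := cP r Cr; have [E1 E2 _] := ex r Cr.
  case/orP=> /eqP yr; last by rewrite yr E2; case/and4P: Cr.
  by have := below k.+1 (c r); rewrite iterSr pc -yr => /(_ yx); rewrite yr cW.
rewrite fx; first exact: below yx.
move=> r Cr; apply/andP; rewrite -negb_or; apply: contra no => zr.
by apply/existsP; exists r; rewrite Cr.
Qed.

Let to_hub z : z \notin N -> exists k, iter k par z = v.
Proof.
have [n] := ubnP (dep z); elim: n z => [//|n IH] z dz zN.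
have [->|zv] := eqVneq z v; first by exists 0.
have [pN E _] := parP zN zv; have [|k kv] := IH (par z) _ pN; first by rewrite -E.
by exists k.+1; rewrite iterSr.
Qed.

(** Each block ends with [v] drained, and everything outside [N] descends from [v]; so while [W] is
    nonempty, one of its agents has arrived at [v]. Removing it affects the invariant only at
    [v]. *)
Lemma drain m (W : {set G}) : W \subset ~: N -> #|W| <= m ->
    (forall x, x != v -> drained false W x) ->
  exists bs, [/\ size bs <= m, forall b, b \in bs -> block b &
    forall y, y \in W -> visits bs y].
Proof.
elim: m W => [|m IH] W WN Wm inv.
  exists [::]; split=> // y; move: Wm; rewrite leqn0 cards_eq0 => /eqP->; by rewrite inE.
have [->|[w wW]] := set_0Vmem W.
  by exists [::]; split=> // y; rewrite inE.
have imN s (X : {set G}) : all (@matching G) s -> X \subset ~: N ->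
    (forall u, u \in N -> position s u = u) -> position s @: X \subset ~: N.
  move=> ms /subsetP XN sN; apply/subsetP => _ /imsetP[x xX ->]; rewrite inE.
  apply: contraTN (xX) => xN; apply/negP => /XN; rewrite inE -(position_inj ms (sN _ xN)).
  by rewrite xN.
have [s1 [ms1 sz1 sN1 inv1]] := drain_round WN inv.
have [s2 [ms2 sz2 sN2 inv2]] := drain_round (imN _ _ ms1 WN sN1) (fun x _ => inv1 x).
set b := s1 ++ s2; set W2 := position b @: W.
have bb : block b.
  by split=> [||u uN]; rewrite ?all_cat ?ms1 ?size_cat ?sz1 ?sz2 // position_cat sN1 ?sN2.
have [mb _ bN] := bb.
have W2E : W2 = position s2 @: (position s1 @: W).
  by rewrite -imset_comp; apply: eq_imset => x; rewrite /= position_cat.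
have cW2 : #|W2| = #|W| by rewrite card_imset //; apply: position_inj.
have vW2 : v \in W2.
  have W2w : position b w \in W2 by apply: imset_f.
  have /subsetP/(_ _ W2w) := imN _ _ mb WN bN; rewrite inE => /to_hub[k kv].
  apply: contraTT (W2w); rewrite W2E => vW; apply: (inv2 v) kv => //.
  by rewrite dep_v.
have [||x xv xN xe|bs [szbs bbs vis]] := IH (W2 :\ v).
- by apply: subset_trans (subD1set _ _) _; apply: imN.
- by rewrite -ltnS; apply: leq_trans Wm; rewrite -cW2 (cardsD1 v W2) vW2.
- rewrite !inE xv /= => xW k y yx; rewrite W2E in xW *.
  by rewrite inE negb_and (inv2 x xN xe xW k y yx) orbT.
exists (b :: bs); split=> // [b'|y yW].
  by rewrite inE => /predU1P[->//|]; apply: bbs.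
have [yv|yv] := eqVneq (position b y) v.
  by exists 1; rewrite /= take0 cats0.
have [|k kv] := vis (position b y); first by rewrite !inE yv /=; apply: imset_f.
by exists k.+1; rewrite /= position_cat.
Qed.

End HubTree.

(** * Loading a group of visitors into the neighbourhood *)

Let visits_cons b bs y : visits (b :: bs) y -> y != v -> visits bs (position b y).
Proof.
case=> -[|k] /=; first by rewrite /position /= => ->; rewrite eqxx.
by rewrite position_cat => kv _; exists k.
Qed.

Lemma swap_edge_only (x y : G) : adj x y ->
  exists2 M, matching M & forall z, swap M z = tperm x y z.
Proof.
move=> xy; have [_ _||M mM [MP _]] := @parallel_step G unit predT (fun=> setT) (fun=> x) (fun=> y).
- by rewrite !inE /lazy xy orbT.
- by move=> [] [].
by exists M => // z; apply: (MP tt).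
Qed.

(** [F] holds the free slots, [U] the candidates, [W] those who get a slot; loading stops when slots
    or candidates run out. *)
Let loaded c (U F : {set G}) := exists s (W : {set G}),
  [/\ all (@matching G) s, size s <= c,
    [/\ W \subset U, forall x, x \in W -> position s x \in F &
        #|W| = #|F| \/ W = U] &
    forall u, u \in N -> u \notin F -> position s u = u].

Let loadable bs (U F : {set G}) :=
  [/\ U \subset ~: N, F \subset N & forall y, y \in U -> visits bs y].

(** A candidate at [v] takes a free slot in one round; no other candidate moves, so the visits
    promised by [bs] stand. *)
Let load_at_hub bs c :
    (forall U F : {set G}, v \notin U -> loadable bs U F -> loaded c U F) ->
  forall U F : {set G}, loadable bs U F -> loaded c.+1 U F.
Proof.
move=> H U F [UN FN vis].
have weaken : loaded c U F -> loaded c.+1 U F.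
  by case=> s [W [ms sz PW fx]]; exists s, W; split=> //; apply: leqW.
have [vU|vU] := boolP (v \in U); last exact/weaken/H.
have [F0|[f fF]] := set_0Vmem F.
  exists [::], set0; rewrite F0; split=> //; split=> [|x|]; rewrite ?sub0set ?inE //.
  by left.
have fN := subsetP FN _ fF.
have [M mM MP] := swap_edge_only (vN fN).
have [||s [W [ms sz [WU WF WE] fx]]] := H (U :\ v) (F :\ f).
- by rewrite !inE eqxx.
- split=> [||y]; first exact: subset_trans (subD1set _ _) UN.
    exact: subset_trans (subD1set _ _) FN.
  by rewrite !inE => /andP[_]; apply: vis.
have posv : position (M :: s) v = f.
  by rewrite /position /= MP tpermL; apply: fx; rewrite // !inE eqxx.
have posD z : z != v -> z != f -> position (M :: s) z = position s z.
  by move=> zv zf; rewrite /position /= MP tpermD // eq_sym.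
have vW : v \notin W by apply/negP => /(subsetP WU); rewrite !inE eqxx.
exists (M :: s), (v |: W); split=> [|//||u uN uF]; first by rewrite /= mM.
  split=> [|x|]; first by rewrite subUset sub1set vU (subset_trans WU) ?subD1set.
    rewrite !inE => /predU1P[->|xW]; first by rewrite posv.
    have /setD1P[xv xU] := subsetP WU _ xW.
    rewrite posD //; first by have /setD1P[] := WF _ xW.
    by apply: contraTneq fN => <-; have := subsetP UN _ xU; rewrite inE.
  case: WE => [WE|->]; last by right; rewrite setD1K.
  by left; rewrite cardsU1 vW WE (cardsD1 f F) fF.
rewrite posD; first by apply: fx; rewrite // !inE (negPf uF) andbF.
  by apply: contraNneq v_notin => <-.
by apply: contraNneq uF => ->.
Qed.

(** A block costs 10 rounds and one loading round before it; the successor is the loading round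
    after the last block. *)
Let load bs (U F : {set G}) :
  (forall b, b \in bs -> block b) -> loadable bs U F -> loaded (11 * size bs).+1 U F.
Proof.
elim: bs U F => [|b bs IH] U F bbs; apply: load_at_hub => {}U {}F vU [UN FN vis].
  have U0 y : y \notin U.
    by apply/negP => yU; have [k /= yv] := vis y yU; rewrite -yv /position /= yU in vU.
  exists [::], U; split=> //; split=> [//|x xU|]; last by right.
  by case/negP: (U0 x).
have [mb szb bN] : block b by apply: bbs; rewrite inE eqxx.
have binj := position_inj mb.
have [b' b'bs||s [W [ms sz [WU WF WE] fx]]] := IH (position b @: U) F.
- by apply: bbs; rewrite inE b'bs orbT.
- split=> // [|_ /imsetP[y yU ->]].
    apply/subsetP => _ /imsetP[x xU ->]; rewrite inE; apply: contraTN (xU) => xN.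
    by apply/negP => /(subsetP UN); rewrite inE -(binj _ _ (bN _ xN)) xN.
  by apply: visits_cons (vis _ yU) _; apply: contraNneq vU => <-.
have WE' : W = position b @: (U :&: position b @^-1: W).
  apply/setP => x; apply/idP/imsetP => [xW|[y]]; last by rewrite !inE => /andP[_ yW] ->.
  have /imsetP[y yU xy] := subsetP WU _ xW.
  by exists y; rewrite // !inE yU -xy.
exists (b ++ s), (U :&: position b @^-1: W); split.
- by rewrite all_cat mb.
- by rewrite size_cat szb mulnS (addSnnS 10) leq_add2l.
- split=> [|x|]; first exact: subsetIl.
    by rewrite !inE position_cat => /andP[_ /WF].
  case: WE => [<-|E]; [left|right].
    by rewrite [in RHS]WE' card_imset.
  by apply/setP => x; rewrite !inE E mem_imset // andbb.
by move=> u uN uF; rewrite position_cat bN // fx.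
Qed.

(** Each member of [N] steps onto [v], is there adjacent to all other members, and steps back. *)
Let hub_meet : exists s, [/\ all (@matching G) s, size s <= 2 * #|N| &
  forall x y, x \in N -> y \in N -> x != y -> acquainted s x y].
Proof.
suff H l : {subset l <= N} -> exists s, [/\ all (@matching G) s, size s = 2 * size l,
    forall z, position s z = z &
    forall x y, x \in l -> y \in N -> x != y -> acquainted s x y].
  have [x|s [ms sz _ aq]] := H (enum N); first by rewrite mem_enum.
  by exists s; split=> // [|x y xN]; [rewrite sz -cardE|apply: aq; rewrite mem_enum].
elim: l => [_|u l IH ulN]; first by exists [::].
have [x xl|s [ms sz idS aq]] := IH; first by apply: ulN; rewrite inE xl orbT.
have uN : u \in N by apply: ulN; rewrite inE eqxx.
have [M mM MP] := swap_edge_only (vN uN).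
have id2 z : position [:: M; M] z = z by rewrite /position /= !MP tpermK.
exists ([:: M; M] ++ s); split=> [||z|x y]; first by rewrite /= mM.
- by rewrite size_cat sz /= mulnS.
- by rewrite position_cat id2.
rewrite inE => /predU1P[->|xl] yN xy; last first.
  by apply: acquainted_catr; rewrite !id2; apply: aq.
apply: (@acquainted_now _ [:: M] (M :: s)); rewrite /position /= !MP tpermR.
by rewrite tpermD ?vN //; apply: contraNneq v_notin => ->.
Qed.

(** Visits depend on positions, not on agents, so the same blocks serve twice: first to load [N],
    then to lead all others past the group. *)
Let phase (U : {set G}) : exists s (W : {set G}),
  [/\ all (@matching G) s, size s <= 24 * #|G|, W \subset U, #|W| = #|N| \/ W = U &
    forall x y, x \in W -> y != x -> acquainted s x y].
Proof.
have [par [dep [par_id [dep_v parP]]]] := hub_tree.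
(* No vertex outside [N] is outside [~: N], so the invariant holds vacuously. *)
have [||x xv xN _|bs [szbs bbs vis]] := drain par_id dep_v parP (m := #|G|) (W := ~: N).
- by [].
- exact: max_card.
- by rewrite inE xN.
(* Agents of [U] already in [N] keep their slots. *)
have [||s1 [W1 [ms1 sz1 [WU1 WF1 WE1] fx1]]] := @load bs (U :\: N) (N :\: U).
- exact: bbs.
- split=> [||y]; [by rewrite setDE subsetIr|exact: subsetDl|].
  by rewrite inE => /andP[yN _]; apply: vis; rewrite inE.
have [s3 [ms3 sz3 aq3]] := hub_meet.
have [mbs szbs' bsN] : [/\ all (@matching G) (flatten bs), size (flatten bs) = 10 * size bs &
    forall u, u \in N -> position (flatten bs) u = u].
  elim: (bs) bbs => [|b cs IH] bcs; first by split.
  have [mb szb bN] : block b by apply: bcs; rewrite inE eqxx.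
  have [b' b'cs|mcs szcs csN] := IH; first by apply: bcs; rewrite inE b'cs orbT.
  split=> [||u uN] /=; first by rewrite all_cat mb.
    by rewrite size_cat szb szcs mulnS.
  by rewrite position_cat bN ?csN.
have inj1 := position_inj ms1.
exists (s1 ++ flatten bs ++ s3), ((U :&: N) :|: W1); split.
- by rewrite !all_cat ms1 mbs.
(* With [n = #|G| >= 1], loading takes at most [11 n + 1] rounds, the visits [10 n], and the
   meetings inside [N] another [2 n]. *)
- have G0 : 0 < #|G| by apply/card_gt0P; exists v.
  have NG : #|N| <= #|G| := max_card _.
  by rewrite !size_cat szbs'; lia.
- by rewrite subUset subsetIl (subset_trans WU1) ?subsetDl.
- have dis : [disjoint U :&: N & W1].
    apply/pred0P => x /=; apply/negbTE/negP => /andP[]; rewrite inE => /andP[_ xN].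
    by move/(subsetP WU1); rewrite inE xN.
  case: WE1 => [E|->]; [left|right]; last by rewrite setUC setDE -setIUr setUC setUCr setIT.
  rewrite cardsU (_ : _ :&: W1 = set0) ?cards0 ?subn0; last by apply/eqP; rewrite setI_eq0.
  by rewrite E setIC cardsID.
move=> x y xW yx; apply: acquainted_catr.
have xN : position s1 x \in N.
  case/setUP: xW => [/setIP[xU xN]|/WF1 /setDP[]//].
  by rewrite fx1 // inE xU.
have {yx} : position s1 x != position s1 y by rewrite (inj_eq inj1) eq_sym.
move: (position s1 x) (position s1 y) xN => {x xW}x {}y xN xy.
have [yN|yN] := boolP (y \in N).
  by apply: acquainted_catr; rewrite !bsN //; apply: aq3.
apply: acquainted_cat; have [|k kv] := vis y; first by rewrite inE.
rewrite -(cat_take_drop k bs) flatten_cat; apply: acquainted_now; rewrite kv.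
suff -> : position (flatten (take k bs)) x = x by rewrite adj_sym vN.
have: {subset take k bs <= bs} by move=> b; apply: mem_take.
elim: (take k bs) => [//|b cs IH] bcs /=.
have [_ _ bN] : block b by apply: bbs; apply: bcs; rewrite inE eqxx.
rewrite position_cat bN // IH // => b' b'cs; apply: bcs.
by rewrite inE b'cs orbT.
Qed.

(** Every phase settles [#|N|] agents of [U], except perhaps the last. *)
Lemma hub_acquaintance : 0 < #|N| -> exists s,
  [/\ all (@matching G) s, acquaints_all s & size s <= 24 * #|G| * (#|G| %/ #|N|).+1].
Proof.
move=> N0.
suff H m (U : {set G}) : #|U| <= m -> exists s, [/\ all (@matching G) s,
    size s <= 24 * #|G| * (#|U| %/ #|N|).+1 &
    forall x y, x \in U -> y != x -> acquainted s x y].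
  have [|s [ms sz aq]] := H #|G| setT; first exact: max_card.
  exists s; split=> //; last by move: sz; rewrite cardsT.
  by apply/forallP => x; apply/forallP => y; apply/implyP => xy; apply: aq; rewrite // eq_sym.
elim: m U => [|m IH] U Um.
  exists [::]; split=> // x y; move: Um; rewrite leqn0 cards_eq0 => /eqP->.
  by rewrite inE.
have [s1 [W [ms1 sz1 WU WE aq1]]] := phase U.
case: WE => [WN|WU']; last first.
  by exists s1; split=> // [|x y]; [apply: leq_trans sz1 _; rewrite leq_pmulr|rewrite -WU'; apply: aq1].
have inj1 := position_inj ms1.
have cU' : #|position s1 @: (U :\: W)| = #|U| - #|N|.
  by rewrite card_imset // cardsD (setIidPr WU) WN.
have NU : #|N| <= #|U| by rewrite -WN subset_leq_card.
have [|s2 [ms2 sz2 aq2]] := IH (position s1 @: (U :\: W)).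
  by rewrite cU'; move: Um N0; lia.
exists (s1 ++ s2); split=> [||x y xU yx]; first by rewrite all_cat ms1.
  have -> : #|U| %/ #|N| = ((#|U| - #|N|) %/ #|N|).+1.
    by rewrite -{1}(subnK NU) divnDr ?dvdnn // divnn N0 addn1.
  by rewrite size_cat mulnS leq_add // -cU'.
have [xW|xW] := boolP (x \in W); first by apply: acquainted_cat; apply: aq1.
apply: acquainted_catr; apply: aq2; last by rewrite (inj_eq inj1).
by apply: imset_f; rewrite inE xW.
Qed.

End Hub.

(** * Low degrees *)

Lemma leq_card_bigcup (I T : finType) (A : {set I}) (F : I -> {set T}) k :
  (forall i, i \in A -> #|F i| <= k) -> #|\bigcup_(i in A) F i| <= #|A| * k.
Proof.
move=> Fk; rewrite -sum_nat_const.
apply: (big_rec2 (fun (B : {set T}) m => #|B| <= m)); first by rewrite cards0.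
move=> i m B iA Bm; apply: leq_trans (leq_add (Fk i iA) Bm).
by rewrite cardsU leq_subr.
Qed.

(** At most [d] colours are blocked at a vertex. [conf] may be reflexive, hence the conclusion
    [x = y]. *)
Lemma greedy_coloring (T : finType) (conf : rel T) d :
    symmetric conf -> (forall x, #|[set y | conf x y]| <= d) ->
  exists col : T -> nat, (forall x, col x <= d) /\
    forall x y, conf x y -> col x = col y -> x = y.
Proof.
move=> conf_sym confd.
suff H (l : seq T) : exists col : T -> nat, (forall x, col x <= d) /\
    {in l &, forall x y, conf x y -> col x = col y -> x = y}.
  have [col [cold colP]] := H (enum T); exists col; split=> // x y.
  by apply: colP; rewrite mem_enum.
elim: l => [|z l [col [cold colP]]]; first by exists (fun=> 0).
have [zl|zl] := boolP (z \in l).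
  exists col; split=> // x y; rewrite !inE => /predU1P[->|xl] /predU1P[->|yl] //; exact: colP.
have [k kd kP] : exists2 k, k <= d & forall y, conf z y -> col y != k.
  pose used := [seq col y | y <- enum [set y | conf z y]].
  have [/allP sub|/allPn[k]] := boolP (all (mem used) (iota 0 d.+1)).
    have /(uniq_leq_size (iota_uniq _ _)) : {subset iota 0 d.+1 <= used} by [].
    by rewrite size_iota size_map -cardE ltnNge confd.
  rewrite mem_iota => kd kN; exists k => // y zy; apply: contraNneq kN => <-.
  by apply: map_f; rewrite mem_enum inE.
exists (fun x => if x == z then k else col x); split=> [x|x y]; first by case: ifP.
rewrite !inE.
have [->|xz] := eqVneq x z; have [->|yz] := eqVneq y z => //=.
- by move=> _ _ zy /esym/eqP; rewrite (negPf (kP y zy)).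
- by move=> _ _; rewrite conf_sym => zx /eqP; rewrite (negPf (kP x zx)).
- exact: colP.
Qed.

(* Odd-even transposition on positions [0 .. n-1]: agents travel along the
   cycle of length [2 n] folded onto the positions, at unit speed. *)
Section OddEven.

Variable n : nat.

(** At odd [t], position 0 stays put because [0.-1 = 0]. *)
Definition flip t p :=
  if odd p == odd t then (if p.+1 < n then p.+1 else p) else p.-1.

(** The first half of the cycle runs right, the second half back left. *)
Definition fold m := if m < n then m else (2 * n).-1 - m.

Lemma fold_lt m : m < 2 * n -> fold m < n.
Proof. by rewrite /fold; case: ifP; lia. Qed.

Lemma odd_fold_time e t : odd ((2 * e + t) %% (2 * n)) = odd t.
Proof.
have := congr1 odd (divn_eq (2 * e + t) (2 * n)).
by rewrite !mul2n !oddD oddM !odd_double andbF.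
Qed.

(** Phases start even, so at time [t] they have the parity of [t]: right-movers sit at positions of
    that parity, left-movers at the others. At both ends two consecutive phases share a position,
    which is the pause of an unpaired agent. *)
Lemma flip_fold e t : 0 < n ->
  flip t (fold ((2 * e + t) %% (2 * n))) = fold ((2 * e + t.+1) %% (2 * n)).
Proof.
move=> n0; have n20 : 0 < 2 * n by lia.
have om := odd_fold_time e t; have := ltn_pmod (2 * e + t) n20.
have := divn_eq (2 * e + t) (2 * n); rewrite addnS modnS.
set q := _ %/ _; set m := _ %% _ in om * => E mn.
have dE : (2 * n %| (2 * e + t).+1) = (m.+1 == 2 * n).
  rewrite E -addnS (dvdn_addr _ (dvdn_mull q (dvdnn _))).
  by apply/idP/eqP => [/(dvdn_leq (ltn0Sn _))|->//]; lia.
rewrite {}dE {E} /flip /fold; clearbody m => {q n20}; case: (m.+1 =P 2 * n) => [mE|mE].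
  rewrite n0; have -> : (m < n) = false by lia.
  have -> : (2 * n).-1 - m = 0 by lia.
  by rewrite -om; have -> : odd m by lia.
case: ltnP => mn'.
  rewrite om eqxx; case: ltnP => //; lia.
have -> : (m.+1 < n) = false by lia.
have -> : (odd ((2 * n).-1 - m) == odd t) = false by rewrite -om; lia.
lia.
Qed.

(** Even positions start on the way right, odd ones on the way back, at the even phase
    [2 n - 1 - i]. *)
Lemma unfold_even i : i < n -> exists2 e, e < n & fold (2 * e) = i.
Proof.
move=> ni; have [oi|oi] := boolP (odd i).
  exists (((2 * n).-1 - i)./2); rewrite /fold; first lia.
  have -> : 2 * ((2 * n).-1 - i)./2 = (2 * n).-1 - i by lia.
  by case: ltnP; lia.
exists i./2; rewrite /fold; first lia.
have -> : 2 * i./2 = i by lia.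
by rewrite ni.
Qed.

(** Phases adding up to [2 n - 2] belong to neighbours about to be exchanged: the right-mover sits
    at its phase [m], the other at [m + 1]. The sum is [2 (e + e' + t)] modulo [2 n], which forces
    [t = - (e + e' + 1)] modulo [n]. *)
Lemma meeting_time e e' : e < n -> e' < n -> e != e' ->
  exists2 t, t < n &
    let m := (2 * e + t) %% (2 * n) in let m' := (2 * e' + t) %% (2 * n) in
    m + m' = (2 * n).-2 /\ (m.+1 < n \/ m'.+1 < n).
Proof.
move=> en en' ee'; have n0 : 0 < n by lia.
have small m : m < 2 * n -> m %% (2 * n) = m by apply: modn_small.
have wrap m : 2 * n <= m < 4 * n -> m %% (2 * n) = m - 2 * n.
  by move=> mn; rewrite -{1}(@subnK (2 * n) m) ?modnDr ?small //; lia.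
have [le|gt] := leqP (e + e' + 1) n.
  by exists (n - (e + e' + 1)); rewrite /= ?small; lia.
(* Now exactly the agent with the larger index has wrapped around. *)
exists (2 * n - (e + e' + 1)); first lia.
have [lt|lt|/eqP] := ltngtP e e'; last by rewrite (negPf ee').
  by rewrite /= small ?wrap; lia.
by rewrite /= wrap ?small; lia.
Qed.

End OddEven.

(** * Hamiltonian paths in the cube of a connected graph *)

Section CubePath.

Variable G : sgraph.
Implicit Types (u x y : G) (p q r : seq G).

Definition walk3 x y := [exists a, exists b, [&& lazy x a, lazy a b & lazy b y]].

Lemma walk3P x y : reflect (exists a b, [/\ lazy x a, lazy a b & lazy b y]) (walk3 x y).
Proof.
apply: (iffP existsP) => [[a /existsP[b /and3P[xa ab by_]]]|[a [b [xa ab by_]]]].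
  by exists a, b.
by exists a; apply/existsP; exists b; apply/and3P.
Qed.

Lemma walk3_sym : symmetric walk3.
Proof.
move=> x y; apply/walk3P/walk3P => -[a [b [xa ab by_]]]; exists b, a.
  by split; rewrite lazy_sym.
by split; rewrite lazy_sym.
Qed.

(* Hamiltonian paths in the cube of a tree: the path starts at the root, ends
   next to it, and a new branch is traversed backwards, ending at its root. *)
Inductive cube_path : G -> seq G -> Prop :=
| Cube_root u : cube_path u [:: u]
| Cube_branch u c q r : cube_path u q -> cube_path c r -> adj u c ->
    ~~ has (mem q) r -> cube_path u (q ++ rev r).

Lemma cube_pathP u p : cube_path u p ->
  exists q, [/\ p = u :: q, uniq p, lazy u (last u q) & path walk3 u q].
Proof.
elim=> [{}u|{}u c {}p r _ [q [-> Up lu pu]] _ [r' [-> Ur lc pc]] uc dis].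
  by exists [::]; rewrite /lazy eqxx.
exists (q ++ rev (c :: r')); split=> //.
- by rewrite cat_uniq Up rev_uniq has_rev dis.
- by rewrite last_cat rev_cons last_rcons /lazy uc orbT.
have pc' : path walk3 (last c r') (rev (belast c r')).
  by rewrite rev_path; apply: sub_path pc => x y; rewrite walk3_sym.
rewrite cat_path pu [c :: r']lastI rev_rcons /= pc' andbT.
(* The joint is the walk from the end of [u :: q] through [u] and [c] to the end of [c :: r']. *)
by apply/walk3P; exists u, c; rewrite lazy_sym lu lc /lazy uc orbT.
Qed.

(** [y] becomes a leaf below [x]: the one-vertex piece at [x] gets the branch [[:: y]], and the path
    is rebuilt around it. *)
Lemma cube_path_grow u p x y : cube_path u p -> x \in p -> y \notin p -> adj x y ->
  exists2 p', cube_path u p' & p' =i y :: p.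
Proof.
elim=> [{}u|{}u c q r cq IHq cr IHr uc dis] xp yp xy.
  rewrite inE in xp; rewrite (eqP xp) in xy.
  exists ([:: u] ++ rev [:: y]); last by move=> z; rewrite !inE orbC.
  apply: Cube_branch xy _; [exact: Cube_root|exact: Cube_root|].
  by rewrite /= orbF.
move: xp yp; rewrite !mem_cat !mem_rev negb_or => xp /andP[yq yr].
have [xq|xq] := boolP (x \in q).
  have [q' cq' q'E] := IHq xq yq xy; exists (q' ++ rev r).
    apply: Cube_branch cq' cr uc _; apply/hasPn => z zr /=.
    rewrite q'E inE negb_or (hasPn dis z zr) andbT.
    by apply: contraNneq yr => <-.
  by move=> z; rewrite mem_cat q'E !inE mem_cat orbA.
rewrite (negPf xq) /= in xp.
have [r' cr' r'E] := IHr xp yr xy; exists (q ++ rev r').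
  apply: Cube_branch cq cr' uc _; apply/hasPn => z /=; rewrite r'E inE => /predU1P[->//|].
  exact: (hasPn dis).
by move=> z; rewrite mem_cat mem_rev r'E !inE mem_cat mem_rev orbCA.
Qed.

(** As long as the path misses a vertex, connectedness gives an edge leaving it, along which it
    grows. *)
Lemma hamiltonian_cube u : connected_graph G -> exists p,
  [/\ uniq p, forall x, x \in p & path walk3 (head u p) (behead p)].
Proof.
move=> cG; suff [p cp pT] : exists2 p, cube_path u p & forall x, x \in p.
  by have [q [E U _ pq]] := cube_pathP cp; exists p; split=> //; rewrite E.
suff H m : m <= #|G| -> exists2 p, cube_path u p & m <= #|p|.
  have [//|p cp le] := H #|G|; exists p => // x.
  have [_ E] := subset_leqif_card (subset_predT (mem p)).
  by move: E; rewrite eqn_leq max_card le => /esym/subsetP/(_ x isT).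
elim: m => [_|m IH mG]; first by exists [:: u]; [exact: Cube_root|].
have [p cp pm] := IH (ltnW mG).
have [pT|] := boolP [forall x, x \in p].
  exists p => //; rewrite (@eq_card _ _ predT) // => x; exact: (forallP pT).
rewrite negb_forall => /existsP[z zp].
have [/existsP[x /existsP[y /and3P[xp yp xy]]]|no] :=
    boolP [exists x, exists y, [&& x \in p, y \notin p & adj x y]].
  have [p' cp' p'E] := cube_path_grow cp xp yp xy; exists p' => //.
  have -> : #|p'| = #|[predU1 y & p]| by apply: eq_card => w; rewrite p'E !inE.
  by rewrite cardU1 yp.
have: closed (@adj G) [pred x | x \in p].
  apply: intro_closed => [|x y xy /= xp]; rewrite ?inE.
    exact/sym_connect_sym/adj_sym.
  apply: contraNT no => yp; apply/existsP; exists x; apply/existsP; exists y.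
  by rewrite xp xy yp.
move=> /closed_connect/(_ _ _ (cG u z)).
have [q [E _ _ _]] := cube_pathP cp.
by rewrite !inE /= (negPf zp) E inE eqxx.
Qed.

End CubePath.

(** * Simulating odd-even transposition in a graph of low degree *)

Section LowDegree.

Variables (G : sgraph) (D : nat).
Hypotheses (cG : connected_graph G) (degD : forall x : G, #|[set y | lazy x y]| <= D).

Lemma card_walk3 (x : G) : #|[set z | walk3 z x]| <= D ^ 3.
Proof.
pose B (y : G) := [set z | lazy y z].
apply: (@leq_trans #|\bigcup_(b in B x) \bigcup_(a in B b) B a|).
  apply/subset_leq_card/subsetP => z; rewrite inE walk3_sym => /walk3P[a [b [xa ab bz]]].
  by apply/bigcupP; exists a; rewrite ?inE //; apply/bigcupP; exists b; rewrite ?inE.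
apply: (@leq_trans (#|B x| * (D * D))); last by rewrite 2!expnS expn1 leq_mul2r degD orbT.
apply: leq_card_bigcup => b _; apply: (@leq_trans (#|B b| * D)).
  by apply: leq_card_bigcup => a _; apply: degD.
by rewrite leq_mul2r degD orbT.
Qed.

Lemma low_degree_acquaintance : exists s,
  [/\ all (@matching G) s, acquaints_all s & size s <= 5 * (4 * D ^ 3).+1 * #|G|].
Proof.
have [G0|/card_gt0P[u _]] := posnP #|G|.
  exists [::]; split=> //; apply/forallP => x; by have := fintype0 x; rewrite G0.
have [p [Up pT pp]] := hamiltonian_cube u cG.
set n := #|G|; have sp : size p = n by rewrite -(card_uniqP Up); apply: eq_card.
pose at_ i := nth u p i.
have at_inj i j : i < n -> j < n -> at_ i = at_ j -> i = j.
  by move=> ni nj /eqP; rewrite nth_uniq ?sp // => /eqP.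
have at_neq i j : i < n -> j < n -> i != j -> at_ i != at_ j.
  by move=> ni nj; apply: contraNneq => /at_inj->.
have at_walk (i : 'I_n.-1) : exists w : G * G, route (at_ i) w.1 w.2 (at_ i.+1).
  have ni : i.+1 < n by have := ltn_ord i; lia.
  have /walk3P[a [b [xa ab by_]]] : walk3 (at_ i) (at_ i.+1).
    have: i.+1 < size p by rewrite sp.
    move: pp; rewrite /at_; case: (p) => [//|v q] /= /(pathP u) Q lt.
    exact: (Q i).
  have [|a' [b' r]] := @route_of_walk G (at_ i) a b (at_ i.+1) _ xa ab by_.
    by apply/eqP => /at_inj; lia.
  by exists (a', b').
have [w wP] := fin_all_exists at_walk.
pose rt (i : 'I_n.-1) := [:: at_ i; (w i).1; (w i).2; at_ i.+1].
pose conf i j := has (mem (rt i)) (rt j).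
have [|i|col [colK colP]] := @greedy_coloring _ conf (4 * D ^ 3).
- by move=> i j; apply: has_sym.
(* A conflicting walk is counted by its start, within distance 3 of one of the at most 4 vertices of
   [rt i]. *)
- have inj : injective (fun j : 'I_n.-1 => at_ j).
    by move=> j k /at_inj E; apply/val_inj/E; have := ltn_ord j; have := ltn_ord k; lia.
  rewrite -(card_imset _ inj).
  apply: (@leq_trans #|\bigcup_(z in [set z in rt i]) [set y | walk3 y z]|).
    apply/subset_leq_card/subsetP => y /imsetP[j]; rewrite inE => /hasP[z zj zi] ->.
    apply/bigcupP; exists z; rewrite inE //; apply/walk3P.
    have /and4P[xa ab by_ _] := wP j.
    have lz x : lazy x x by rewrite /lazy eqxx.
    have {}by_ : lazy (w j).2 (at_ j.+1) by rewrite /lazy by_ orbT.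
    move: zj; rewrite !inE => /or4P[]/eqP->.
    - by exists (at_ j), (at_ j).
    - by exists (at_ j), (at_ j).
    - by exists (at_ j), (w j).1.
    - by exists (w j).1, (w j).2.
  apply: (@leq_trans (#|[set z in rt i]| * D ^ 3)).
    by apply: leq_card_bigcup => z _; apply: card_walk3.
  by rewrite leq_mul2r cardsE (card_size (rt i)) orbT.
pose K := (4 * D ^ 3).+1.
(* Here [s] simulates one step of odd-even transposition. *)
have round t : exists s, [/\ all (@matching G) s, size s = 5 * K,
    forall i, i < n -> position s (at_ i) = at_ (flip n t i) &
    forall i, i.+1 < n -> odd i = odd t -> acquainted s (at_ i) (at_ i.+1)].
  pose C (i : 'I_n.-1) := odd i == odd t.
  have [i _|i j z /eqP Ci /eqP Cj|i _|i j z Ci Cj cij zi zj|s [ms ex fx] sz] :=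
    @schedule_swap G _ C (fun i => at_ i) (fun i => (w i).1) (fun i => (w i).2)
      (fun i => at_ i.+1) K col.
  - exact: wP.
  - have := ltn_ord i; have := ltn_ord j => jn im.
    rewrite !inE => /orP[]/eqP-> /orP[]/eqP/at_inj E; apply: val_inj => /=;
      move: E; lia.
  - exact: colK.
  - by apply: colP => //; apply/hasP; exists z.
  exists s; split=> // [i ni|i ni it].
    rewrite /flip; have [it|it] := eqVneq (odd i) (odd t).
      case: ltnP => [ni1|ni1].
        have lt : i < n.-1 by lia.
        by have [|//] := ex (Ordinal lt); apply/eqP.
      apply: fx => j /eqP Cj; have jn : j < n.-1 := ltn_ord j.
      by split; apply: at_neq; lia.
    case: i ni it => [|i] /= ni it.
      apply: fx => j Cj; have jn : j < n.-1 := ltn_ord j.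
      split; apply: at_neq => //; try lia.
      by apply/eqP => E; case/negP: it; move: Cj; rewrite /C -E.
    have lt : i < n.-1 by lia.
    have [|//] := ex (Ordinal lt); rewrite /C /=.
    by move: it; case: odd; case: odd.
  have lt : i < n.-1 by lia.
  by have [|//] := ex (Ordinal lt); apply/eqP.
pose m e t := (2 * e + t) %% (2 * n).
have n0 : 0 < n by apply/card_gt0P; exists u.
have mn e t : m e t < 2 * n by rewrite ltn_mod; lia.
(* The index [e] names the agent that starts at phase [2 * e]. *)
have run T : exists s, [/\ all (@matching G) s, size s = 5 * K * T,
    forall e, e < n -> position s (at_ (fold n (2 * e))) = at_ (fold n (m e T)) &
    forall t e e', t < T -> e < n -> e' < n -> m e t + m e' t = (2 * n).-2 ->
      (m e t).+1 < n -> acquainted s (at_ (fold n (2 * e))) (at_ (fold n (2 * e')))].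
  elim: T => [|T [s [ms sz ps aq]]].
    exists [::]; split=> // [|e en]; first by rewrite muln0.
    by rewrite /m addn0 modn_small //; lia.
  have [s' [ms' sz' ps' aq']] := round T.
  exists (s ++ s'); split=> [||e en|t e e' tT en en' sm lt].
  - by rewrite all_cat ms.
  - by rewrite size_cat sz sz' mulnS addnC.
  - by rewrite position_cat ps // ps' ?fold_lt // /m flip_fold.
  move: tT; rewrite ltnS leq_eqVlt => /predU1P[tT|tT]; last first.
    exact: acquainted_cat (aq t e e' tT en en' sm lt).
  apply: acquainted_catr; rewrite !ps // -tT.
  have -> : fold n (m e t) = m e t by rewrite /fold (ltnW lt).
  have -> : fold n (m e' t) = (m e t).+1.
    by rewrite /fold; case: ltnP; move: sm lt; have := mn e' t; lia.
  by apply: aq' => //; rewrite -tT odd_fold_time.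
have [s [ms sz _ aq]] := run n.
exists s; split=> //; last by rewrite sz.
apply/forallP => x; apply/forallP => y; apply/implyP => xy.
have atP z : exists2 e, e < n & z = at_ (fold n (2 * e)).
  have zn : index z p < n by rewrite -sp index_mem.
  have [e en E] := unfold_even zn; exists e => //.
  by rewrite E /at_ nth_index.
have [e en xE] := atP x; have [e' en' yE] := atP y.
have ee' : e != e' by apply: contraNneq xy => ee'; rewrite xE yE ee'.
have [t tn [sm [lt|lt]]] := meeting_time en en' ee'; rewrite xE yE.
  exact: (aq t).
by rewrite acquainted_sym; apply: (aq t) => //; rewrite addnC.
Qed.

End LowDegree.

(** * Balancing the two bounds *)

Lemma acquaintance_time_le (G : sgraph) (cG : connected_graph G) (s : seq {set {set G}}) :
  all (@matching G) s -> acquaints_all s -> acquaintance_time cG <= size s.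
Proof.
move=> ms aq; rewrite /acquaintance_time; case: ex_minnP => k _; apply.
by apply/existsP; exists (in_tuple s); rewrite ms.
Qed.

(** From [d = 6] on, [(1 + 1/d)^4 < 2]; the smaller cases are computed. *)
Lemma expn4_le_exp2 d : d ^ 4 <= 32 * 2 ^ d.
Proof.
elim: d => [//|d IH]; have [d6|d6] := ltnP d 6; first by move: d d6 {IH}; do 6?case=> //.
suff H : d.+1 ^ 4 <= 2 * d ^ 4 by apply: leq_trans H _; rewrite [2 ^ d.+1]expnS (mulnCA 32) leq_mul2l.
rewrite -(subnK d6); move: (d - 6) => k; rewrite !expnS expn0; nia.
Qed.

(** With a hub the product is at most [24 n (n/d + 1) d <= 48 n^2]; with low degrees it is at most
    [5 n (4 d^4 + d) <= 5 n (128 n + n) = 645 n^2]. *)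
Lemma acquaintance_time_trunc_log (G : sgraph) (cG : connected_graph G) :
  2 <= #|G| -> acquaintance_time cG * trunc_log 2 #|G| <= 645 * #|G| ^ 2.
Proof.
move=> G2; set n := #|G|; set d := trunc_log 2 n.
have n0 : 0 < n by apply: ltnW.
have dn : 2 ^ d <= n by apply: trunc_logP.
have d0 : 0 < d by rewrite trunc_log_gt0.
have dlen : d <= n by apply: leq_trans dn; apply/ltnW/ltn_expl.
have [/existsP[v dv]|noHub] := boolP [exists v : G, d <= #|[set u | adj v u]|].
  set N := [set u | adj v u] in dv.
  have [||s [ms aq sz]] := @hub_acquaintance G v N cG.
  - by move=> u; rewrite inE.
  - exact: leq_trans dv.
  have := leq_trans (acquaintance_time_le cG ms aq) sz.
  have : n %/ #|N| <= n %/ d by apply: leq_div2l.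
  have := leq_divM n d; rewrite -/n.
  by move: (n %/ #|N|) (n %/ d); nia.
(* All degrees are below [d], which leaves room for [x] itself. *)
have degd (x : G) : #|[set y | lazy x y]| <= d.
  have -> : [set y | lazy x y] = x |: [set y | adj x y].
    by apply/setP => y; rewrite !inE eq_sym.
  rewrite cardsU1 inE adj_irr /= add1n ltnNge.
  by apply: contra noHub => dx; apply/existsP; exists x.
have [s [ms aq sz]] := low_degree_acquaintance cG degd.
have := leq_trans (acquaintance_time_le cG ms aq) sz; rewrite -/n => AC.
have d4 : d ^ 4 <= 32 * n by apply: leq_trans (expn4_le_exp2 d) _; rewrite leq_mul2l dn.
apply: leq_trans (leq_mul AC (leqnn d)) _.
have -> : 5 * (4 * d ^ 3).+1 * n * d = 5 * n * (4 * d ^ 4 + d) by rewrite (expnS d 3); lia.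
by rewrite -mulnn; nia.
Qed.

Import Order.TTheory GRing.Theory Num.Theory.
Local Open Scope ring_scope.

(** With [d] for [trunc_log 2 n], combine [n <= 2^(d+1)], [ln 2 <= 2] and [d + 1 <= 2 d]. *)
Lemma ln_le_trunc_log (R : realType) n :
  (2 <= n)%N -> ln (n%:R : R) <= 4 * (trunc_log 2 n)%:R.
Proof.
move=> n2; have n0 : (0 < n)%N by apply: ltnW.
have d0 : (0 < trunc_log 2 n)%N by rewrite trunc_log_gt0.
have /ltnW nd : (n < 2 ^ (trunc_log 2 n).+1)%N by apply: trunc_log_ltn.
apply: (@le_trans _ _ (ln (2 ^+ (trunc_log 2 n).+1))).
  by rewrite ler_ln ?posrE ?ltr0n ?exprn_gt0 // -natrX ler_nat.
have ln2 : ln (2 : R) <= 2 by apply/ltW/ln_sublinear.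
rewrite lnXn // -[ln 2 *+ _]mulr_natr (le_trans (ler_wpM2r _ ln2)) //.
by rewrite -!natrM ler_nat; lia.
Qed.

Theorem theorem3p2 (R : realType) :
  exists C : R, 0 < C /\
    forall (G : sgraph) (cG : connected_graph G), (2 <= #|G|)%N ->
      (acquaintance_time cG)%:R <= C * (#|G|%:R ^+ 2 / ln (#|G|%:R)).
Proof.
exists (4 * 645); split=> [|G cG G2]; first by rewrite mulr_gt0.
have d0 : 0 < (trunc_log 2 #|G|)%:R :> R by rewrite ltr0n trunc_log_gt0.
have ln0 : 0 < ln (#|G|%:R : R) by rewrite ln_gt0 // ltr1n.
rewrite mulrA ler_pdivlMr // (le_trans (ler_wpM2l _ (ln_le_trunc_log R G2))) //.
rewrite mulrCA -mulrA ler_pM2l // -natrM -natrX -natrM ler_nat.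
exact: acquaintance_time_trunc_log.
Qed.
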